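(* Let $K=\mathbb{Q}(\sqrt{3})$ and let $p$ be a prime number with $p\equiv 1 \pmod 3$. Then the quaternion algebra $\mathbb{H}_K(-1,p)$ is a split algebra.
   Context: For a field $K$ with $\operatorname{char} K\neq 2$ and nonzero $\alpha,\beta\in K$, $\mathbb{H}_K(\alpha,\beta)$ denotes the generalized quaternion algebra over $K$: the associative unital $K$-algebra with basis $\{1,e_1,e_2,e_3\}$ and multiplication $e_1^2=\alpha$, $e_2^2=\beta$, $e_1e_2=e_3=-e_2e_1$. The norm of $a=a_0+a_1e_1+a_2e_2+a_3e_3$ is $n(a)=a_0^2-\alpha a_1^2-\beta a_2^2+\alpha\beta a_3^2$. The algebra $\mathbb{H}_K(\alpha,\beta)$ is a division algebra if and only if $n(x)=0$ only for $x=0$; otherwise it is called split. *)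

(* Defs.v *)
From HB Require Import structures.
From mathcomp Require Import all_boot all_order all_algebra all_field.
From mathcomp Require Import ring.

Set Implicit Arguments.
Unset Strict Implicit.
Unset Printing Implicit Defensive.

Import GRing.Theory Num.Theory.
Local Open Scope ring_scope.

(* The generalized quaternion algebra H_K(a, b): [Quat x0 x1 x2 x3] is
   x0 + x1 e1 + x2 e2 + x3 e3.  The construction is meaningful for all a and b;
   the usual theory assumes 2, a and b nonzero in K. *)
Record quat (K : fieldType) (a b : K) :=
  Quat { qc0 : K; qc1 : K; qc2 : K; qc3 : K }.

Definition quat_encode (K : fieldType) (a b : K) (x : quat a b) :=
  (qc0 x, qc1 x, qc2 x, qc3 x).

Definition quat_decode (K : fieldType) (a b : K) (t : K * K * K * K) :=
  let: (x0, x1, x2, x3) := t in Quat a b x0 x1 x2 x3.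

Lemma quat_encodeK (K : fieldType) (a b : K) :
  cancel (@quat_encode K a b) (quat_decode a b).
Proof. by case. Qed.

HB.instance Definition _ (K : fieldType) (a b : K) :=
  Choice.copy (quat a b) (can_type (@quat_encodeK K a b)).

Definition quat_zero (K : fieldType) (a b : K) := Quat a b 0 0 0 0.
Definition quat_one (K : fieldType) (a b : K) := Quat a b 1 0 0 0.
Definition quat_e1 (K : fieldType) (a b : K) := Quat a b 0 1 0 0.
Definition quat_e2 (K : fieldType) (a b : K) := Quat a b 0 0 1 0.
Definition quat_e3 (K : fieldType) (a b : K) := Quat a b 0 0 0 1.

Definition quat_opp (K : fieldType) (a b : K) (x : quat a b) :=
  let: Quat x0 x1 x2 x3 := x in Quat a b (- x0) (- x1) (- x2) (- x3).

Definition quat_add (K : fieldType) (a b : K) (x y : quat a b) :=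
  let: Quat x0 x1 x2 x3 := x in let: Quat y0 y1 y2 y3 := y in
  Quat a b (x0 + y0) (x1 + y1) (x2 + y2) (x3 + y3).

Definition quat_scale (K : fieldType) (a b : K) (k : K) (x : quat a b) :=
  let: Quat x0 x1 x2 x3 := x in Quat a b (k * x0) (k * x1) (k * x2) (k * x3).

(* The bilinear extension of e1^2 = a, e2^2 = b, e1 e2 = e3 = - e2 e1, which
   force e3^2 = - a b, e1 e3 = a e2 = - e3 e1 and e3 e2 = b e1 = - e2 e3. *)
Definition quat_mul (K : fieldType) (a b : K) (x y : quat a b) :=
  let: Quat x0 x1 x2 x3 := x in let: Quat y0 y1 y2 y3 := y in
  Quat a b
    (x0 * y0 + a * (x1 * y1) + b * (x2 * y2) - a * b * (x3 * y3))
    (x0 * y1 + x1 * y0 - b * (x2 * y3) + b * (x3 * y2))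
    (x0 * y2 + x2 * y0 + a * (x1 * y3) - a * (x3 * y1))
    (x0 * y3 + x3 * y0 + x1 * y2 - x2 * y1).

Lemma quat_addA (K : fieldType) (a b : K) : associative (@quat_add K a b).
Proof. by case=> ? ? ? ? [? ? ? ?] [? ? ? ?]; rewrite /= !addrA. Qed.

Lemma quat_addC (K : fieldType) (a b : K) : commutative (@quat_add K a b).
Proof. by case=> ? ? ? ? [? ? ? ?] /=; congr Quat; rewrite addrC. Qed.

Lemma quat_add0 (K : fieldType) (a b : K) :
  left_id (quat_zero a b) (@quat_add K a b).
Proof. by case=> ? ? ? ?; rewrite /= !add0r. Qed.

Lemma quat_addN (K : fieldType) (a b : K) :
  left_inverse (quat_zero a b) (@quat_opp K a b) (@quat_add K a b).
Proof. by case=> ? ? ? ?; rewrite /= !addNr. Qed.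

HB.instance Definition _ (K : fieldType) (a b : K) :=
  GRing.isZmodule.Build (quat a b)
    (@quat_addA K a b) (@quat_addC K a b) (@quat_add0 K a b) (@quat_addN K a b).

Lemma quat_mulA (K : fieldType) (a b : K) : associative (@quat_mul K a b).
Proof. by case=> ? ? ? ? [? ? ? ?] [? ? ? ?] /=; congr Quat; ring. Qed.

Lemma quat_mul1l (K : fieldType) (a b : K) :
  left_id (quat_one a b) (@quat_mul K a b).
Proof. by case=> ? ? ? ? /=; congr Quat; ring. Qed.

Lemma quat_mul1r (K : fieldType) (a b : K) :
  right_id (quat_one a b) (@quat_mul K a b).
Proof. by case=> ? ? ? ? /=; congr Quat; ring. Qed.

Lemma quat_mulDl (K : fieldType) (a b : K) :
  left_distributive (@quat_mul K a b) +%R.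
Proof.
by case=> ? ? ? ? [? ? ? ?] [? ? ? ?]; rewrite /GRing.add /=; congr Quat; ring.
Qed.

Lemma quat_mulDr (K : fieldType) (a b : K) :
  right_distributive (@quat_mul K a b) +%R.
Proof.
by case=> ? ? ? ? [? ? ? ?] [? ? ? ?]; rewrite /GRing.add /=; congr Quat; ring.
Qed.

Lemma quat_one_neq0 (K : fieldType) (a b : K) : quat_one a b != 0.
Proof. by apply/eqP=> -[] /eqP; rewrite oner_eq0. Qed.

HB.instance Definition _ (K : fieldType) (a b : K) :=
  GRing.Zmodule_isNzRing.Build (quat a b)
    (@quat_mulA K a b) (@quat_mul1l K a b) (@quat_mul1r K a b)
    (@quat_mulDl K a b) (@quat_mulDr K a b) (@quat_one_neq0 K a b).

Lemma quat_scaleA (K : fieldType) (a b : K) (k l : K) (x : quat a b) :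
  quat_scale k (quat_scale l x) = quat_scale (k * l) x.
Proof. by case: x => ? ? ? ?; rewrite /= !mulrA. Qed.

Lemma quat_scale1 (K : fieldType) (a b : K) :
  left_id 1 (@quat_scale K a b).
Proof. by case=> ? ? ? ?; rewrite /= !mul1r. Qed.

Lemma quat_scaleDr (K : fieldType) (a b : K) :
  right_distributive (@quat_scale K a b) +%R.
Proof. by move=> ? [? ? ? ?] [? ? ? ?]; rewrite /GRing.add /= !mulrDr. Qed.

Lemma quat_scaleDl (K : fieldType) (a b : K) (x : quat a b) :
  {morph (@quat_scale K a b)^~ x : k l / k + l}.
Proof. by case: x => ? ? ? ? k l; rewrite /GRing.add /= !mulrDl. Qed.

HB.instance Definition _ (K : fieldType) (a b : K) :=
  GRing.Zmodule_isLmodule.Build K (quat a b)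
    (@quat_scaleA K a b) (@quat_scale1 K a b)
    (@quat_scaleDr K a b) (@quat_scaleDl K a b).

Lemma quat_scaleAl (K : fieldType) (a b : K) (k : K) (x y : quat a b) :
  k *: (x * y) = (k *: x) * y.
Proof.
case: x y => ? ? ? ? [? ? ? ?].
by rewrite /GRing.mul /GRing.scale /=; congr Quat; ring.
Qed.

HB.instance Definition _ (K : fieldType) (a b : K) :=
  GRing.Lmodule_isLalgebra.Build K (quat a b) (@quat_scaleAl K a b).

Lemma quat_scaleAr (K : fieldType) (a b : K) (k : K) (x y : quat a b) :
  k *: (x * y) = x * (k *: y).
Proof.
case: x y => ? ? ? ? [? ? ? ?].
by rewrite /GRing.mul /GRing.scale /=; congr Quat; ring.
Qed.

HB.instance Definition _ (K : fieldType) (a b : K) :=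
  GRing.Lalgebra_isAlgebra.Build K (quat a b) (@quat_scaleAr K a b).

Lemma quat_basis (K : fieldType) (a b x0 x1 x2 x3 : K) :
  Quat a b x0 x1 x2 x3 =
  x0 *: 1 + x1 *: quat_e1 a b + x2 *: quat_e2 a b + x3 *: quat_e3 a b.
Proof. by rewrite /GRing.scale /GRing.add /=; congr Quat; ring. Qed.

Lemma quat_relations (K : fieldType) (a b : K) :
  [/\ quat_e1 a b * quat_e1 a b = a%:A, quat_e2 a b * quat_e2 a b = b%:A,
      quat_e1 a b * quat_e2 a b = quat_e3 a b &
      quat_e3 a b = - (quat_e2 a b * quat_e1 a b)].
Proof.
by split; rewrite /GRing.scale /GRing.mul /GRing.opp /=; congr Quat; ring.
Qed.

Definition quat_norm (K : fieldType) (a b : K) (x : quat a b) : K :=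
  qc0 x ^+ 2 - a * qc1 x ^+ 2 - b * qc2 x ^+ 2 + a * b * qc3 x ^+ 2.

Definition division_algebra (K : fieldType) (A : algType K) : Prop :=
  forall x : A, x != 0 -> exists y : A, x * y = 1 /\ y * x = 1.

Definition quat_split (K : fieldType) (a b : K) : Prop :=
  ~ division_algebra (quat a b).

Lemma quat_normM (K : fieldType) (a b : K) (x y : quat a b) :
  quat_norm (x * y) = quat_norm x * quat_norm y.
Proof.
rewrite -[x * y]/(quat_mul x y); case: x y => ? ? ? ? [? ? ? ?].
by rewrite /quat_norm /=; ring.
Qed.

Lemma quat_division_normP (K : fieldType) (a b : K) :
  division_algebra (quat a b) <->
  (forall x : quat a b, quat_norm x = 0 -> x = 0).
Proof.
split=> [div_ab x nx0 | an_ab x x_neq0].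
  apply/eqP; apply: contraT => /div_ab[y [xy1 _]].
  have := quat_normM x y; rewrite xy1 nx0 mul0r => /eqP.
  suff -> : quat_norm (1 : quat a b) = 1 by rewrite oner_eq0.
  by change (quat_norm (quat_one a b) = 1); rewrite /quat_norm /quat_one /=; ring.
have nx_neq0 : quat_norm x != 0.
  by apply: contraNN x_neq0 => /eqP/an_ab->.
case: x nx_neq0 {x_neq0} => x0 x1 x2 x3; set n := quat_norm _ => n_neq0.
exists (n^-1 *: Quat a b x0 (- x1) (- x2) (- x3)).
rewrite -scalerAr -scalerAl.
suff [-> ->] : Quat a b x0 x1 x2 x3 * Quat a b x0 (- x1) (- x2) (- x3) = n%:A
             /\ Quat a b x0 (- x1) (- x2) (- x3) * Quat a b x0 x1 x2 x3 = n%:A.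
  by rewrite scalerA mulVf // scale1r.
have -> : n%:A = Quat a b n 0 0 0.
  by rewrite -[n%:A]/(quat_scale n (quat_one a b)) /= mulr1 mulr0.
rewrite -[X in X = _ /\ _]/(quat_mul _ _) -[X in _ /\ X = _]/(quat_mul _ _).
by rewrite /n /quat_norm /=; split; congr Quat; ring.
Qed.

(* K is Q(sqrt 3): s plays the role of sqrt 3 and generates K over Q. *)
Definition is_Qsqrt3 (K : fieldExtType rat) (s : K) : Prop :=
  s ^+ 2 = 3%:R /\ <<1; s>>%VS = fullv.

Lemma Qsqrt3_exists : exists (K : fieldExtType rat) (s : K), is_Qsqrt3 s.
Proof.
have [K [KC [s1 s1C s1gen]]] := num_field_exists [:: 2.-root 3%:R].
case: s1 s1C s1gen => [|s [|? ?]] // [sC] sgen.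
exists K, s; split; last by rewrite -sgen adjoin_seq1.
by apply: (fmorph_inj KC); rewrite rmorphXn sC rootCK ?rmorph_nat.
Qed.

(* Main.v *)
Require Import Defs.
From mathcomp Require Import all_boot all_order all_algebra all_field.
From mathcomp Require Import all_fingroup all_solvable.
From mathcomp Require Import zify ring.
Import GRing.Theory Num.Theory.
Local Open Scope ring_scope.

(** With s ^+ 2 = 3, the norm form of the algebra is
    x0 ^+ 2 + x1 ^+ 2 - p (x2 ^+ 2 + x3 ^+ 2), and x ^+ 2 + 3 y ^+ 2 is the sum
    of the squares of x and s y.  A zero of the norm therefore comes from
    integers x, y with x ^+ 2 + 3 y ^+ 2 = k p, as soon as k is itself a sum of
    two squares in K.

    Since 3 divides p - 1, the field 'F_p contains a primitive cube root of
    unity, hence a square root t of -3 ([sqrtN3_exists]).  By the pigeonhole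
    principle there are x, y, not both zero and of absolute value at most the
    integer part of the square root of p, such that x = t y modulo p
    ([thue_lemma]).  Then p divides x ^+ 2 + 3 y ^+ 2, which lies between 1 and
    4 p, so that k is 1, 2, 3 or 4 ([multiple_sqD3sq]); in K these are 1 ^+ 2,
    1 ^+ 2 + 1 ^+ 2, s ^+ 2 and 2 ^+ 2. *)

(** A primitive cube root of unity w satisfies w ^+ 2 + w + 1 = 0, whose
    discriminant is -3. *)
Lemma sqrtN3_exists (F : finFieldType) :
  (3 %| #|F|.-1)%N -> exists t : F, t ^+ 2 = - 3%:R.
Proof.
rewrite -card_finField_unit => /(Cauchy (isT : prime 3))[u _ ord_u].
have u_neq1 : FinRing.uval u - 1 != 0.
  by rewrite subr_eq0 -[1]/(FinRing.uval 1%g) (inj_eq val_inj) -order_eq1 ord_u.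
have u3 : FinRing.uval u ^+ 3 = 1.
  by rewrite -FinRing.val_unitX -ord_u expg_order.
set w := FinRing.uval u in u_neq1 u3.
have w_eq : w ^+ 2 + w + 1 = 0.
  apply: (mulfI u_neq1); rewrite mulr0.
  transitivity (w ^+ 3 - 1); first by ring.
  by rewrite u3 subrr.
exists (2%:R * w + 1).
transitivity (4%:R * (w ^+ 2 + w + 1) - 3%:R); first by ring.
by rewrite w_eq mulr0 sub0r.
Qed.

(** There are (m + 1) ^ 2 differences a - t b with a, b in {0, .., m}, more
    than there are elements of R, so two of them agree; subtract. *)
Lemma thue_lemma (R : finNzRingType) (t : R) (m : nat) :
  (#|R| < m.+1 ^ 2)%N ->
  exists x y : int, [/\ (`|x| <= m)%N, (`|y| <= m)%N, (x != 0) || (y != 0) &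
                        x%:~R = t * y%:~R :> R].
Proof.
move=> ltRm.
pose f (u : 'I_m.+1 * 'I_m.+1) : R := (u.1 : nat)%:R - t * (u.2 : nat)%:R.
have /injectivePn[[a b] [[c d]]] : ~~ injectiveb f.
  apply/negP=> /injectiveP/leq_card.
  by rewrite card_prod card_ord mulnn leqNgt ltRm.
rewrite xpair_eqE negb_and => neq_ab; rewrite /f /= => eqf.
have lea := ltn_ord a; have leb := ltn_ord b.
have lec := ltn_ord c; have led := ltn_ord d.
exists (a%:Z - c%:Z), (b%:Z - d%:Z); split; [lia | lia | | ].
  by rewrite !subr_eq0 !eqz_nat.
move: eqf; rewrite !rmorphB /= -!pmulrn mulrBr => eqf.
by rewrite -[a%:R](subrK (t * b%:R)) eqf -addrA addrC addrA subrK.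
Qed.

Lemma sqrtn_exists (n : nat) : exists m, (m ^ 2 <= n < m.+1 ^ 2)%N.
Proof.
elim: n => [|n [m]]; first by exists 0%N.
have [ltn1 | gen1] := ltnP n.+1 (m.+1 ^ 2) => /andP[lemn ltnm].
  by exists m; apply/andP; split; lia.
by exists m.+1; apply/andP; split; [| move: gen1 ltnm; nia].
Qed.

(** The bound k <= 4 is what makes k a sum of two squares in any ring in which
    3 is a square. *)
Lemma multiple_sqD3sq (p : nat) : prime p -> (p = 1 %[mod 3])%N ->
  exists x y k : nat, (x ^ 2 + 3 * y ^ 2 = k * p)%N /\ (0 < k <= 4)%N.
Proof.
move=> p_pr p1; have p_gt0 := prime_gt0 p_pr.
have [|t t2] := @sqrtN3_exists 'F_p.
  by rewrite card_Fp // -subn1 -eqn_mod_dvd //; apply/eqP.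
have [m /andP[lemp ltpm]] := sqrtn_exists p.
have [|x [y [lexm leym xy_neq0 eqxy]]] := @thue_lemma 'F_p t m.
  by rewrite card_Fp.
have sq_abs (z : int) : (`|z|%N%:R ^+ 2 : 'F_p) = z%:~R ^+ 2.
  by rewrite [in RHS](intEsign z) rmorphM rmorph_sign exprMn sqrr_sign mul1r.
have /dvdnP[k Nk] : (p %| `|x| ^ 2 + 3 * `|y| ^ 2)%N.
  rewrite (dvdn_pcharf (pchar_Fp p_pr)) natrD natrM !natrX !sq_abs eqxy.
  by rewrite exprMn t2 mulNr addNr.
exists `|x|%N, `|y|%N, k; split=> //.
apply/andP; split.
  by rewrite lt0n; apply/eqP=> k0; move: Nk xy_neq0; rewrite k0; nia.
rewrite -(leq_pmul2r p_gt0) -Nk.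
have := leq_mul lexm lexm; have := leq_mul leym leym; lia.
Qed.

Theorem proposition2p2 (K : fieldExtType rat) (s : K) (hK : is_Qsqrt3 s)
    (p : nat) (hp : prime p) (hp3 : (p = 1 %[mod 3])%N) :
  quat_split (- 1 : K) p%:R.
Proof.
have [s2 _] := hK; move/quat_division_normP=> an_norm.
have [x [y [k [Nk k14]]]] := multiple_sqD3sq _ hp hp3.
have [c [d [kcd cd_neq0]]] :
    exists c d : K, c ^+ 2 + d ^+ 2 = k%:R /\ c != 0.
  have nz n : n.+1%:R != 0 :> K.
    by rewrite -(rmorph_nat (in_alg K)) fmorph_eq0 pnatr_eq0.
  case: k k14 {Nk} => [|[|[|[|[|//]]]]] // _.
  - by exists 1, 0; rewrite oner_eq0; split=> //; ring.
  - by exists 1, 1; rewrite oner_eq0; split=> //; ring.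
  - exists s, 0; split; first by rewrite s2; ring.
    by rewrite -sqrf_eq0 s2.
  - by exists 2%:R, 0; split=> //; ring.
have /an_norm/(congr1 (@qc2 _ _ _))/= c0 :
    quat_norm (Quat (- 1) p%:R x%:R (s * y%:R) c d) = 0.
  rewrite /quat_norm /=.
  transitivity ((x%:R ^+ 2 + s ^+ 2 * y%:R ^+ 2) - (c ^+ 2 + d ^+ 2) * p%:R : K).
    by ring.
  by rewrite s2 kcd -!natrX -!natrM -natrD Nk subrr.
by rewrite c0 eqxx in cd_neq0.
Qed.
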